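(* Let $k\ge 1$ be an integer. The standard $k$-bit Gray code has transition counts $(2^{k-1},2^{k-2},\dots,4,2,1)$, and it is the only $k$-bit Gray code, up to choosing a starting node, with these transition counts; that is, for every fixed first column in $\{0,1\}^k$ there is exactly one $k$-bit Gray code with that first column and with transition counts $(2^{k-1},2^{k-2},\dots,4,2,1)$. Moreover, up to permutation these are the only transition counts that are represented by an odd number of Gray codes: for a tuple $(c_1,\dots,c_k)$ of non-negative integers and a fixed first column $g\in\{0,1\}^k$, the number of $k$-bit Gray codes with first column $g$ and transition counts $(c_1,\dots,c_k)$ is odd if and only if $(c_1,\dots,c_k)$ is a permutation of $(2^{k-1},2^{k-2},\dots,2,1)$.
   Context: A $k$-bit Gray code is a $k\times 2^k$ binary matrix $G=(g_1,\dots,g_{2^k})$ whose columns are all the vectors of $\{0,1\}^k$ (each exactly once) such that any two consecutive columns differ in exactly one entry; it is not required that the last and first column differ in one entry. The starting node of $G$ is its first column $g_1$. Changing the starting node means inverting all bits in some of the rows. The transition counts of $G$ are $(c_1,\dots,c_k)$, where $c_i$ is the number of indices $m\in\{1,\dots,2^k-1\}$ such that $g_m$ and $g_{m+1}$ differ in row $i$. The standard $k$-bit Gray code is defined inductively: the standard $1$-bit Gray code is $((0),(1))$; for $k>1$ the standard $k$-bit Gray code is the list of the columns of the standard $(k-1)$-bit Gray code, each with $0$ appended as last entry, followed by the columns of the standard $(k-1)$-bit Gray code in reverse order, each with $1$ appended as last entry. *)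

(* Defs.v *)
From mathcomp Require Import all_boot all_algebra.

Set Implicit Arguments.
Unset Strict Implicit.
Unset Printing Implicit Defensive.

Definition gray_code (k : nat) (G : 'M[bool]_(k, 2 ^ k)) : bool :=
  [forall v : 'cV[bool]_k, #|[set j : 'I_(2 ^ k) | col j G == v]| == 1] &&
  [forall m : 'I_(2 ^ k), forall m' : 'I_(2 ^ k),
     (m' == m.+1 :> nat) ==> (#|[set i : 'I_k | G i m != G i m']| == 1)].

Lemma pow2_gt0 (k : nat) : 0 < 2 ^ k.
Proof. by rewrite expn_gt0. Qed.

Definition first_col (k : nat) (G : 'M[bool]_(k, 2 ^ k)) : 'cV[bool]_k :=
  col (Ordinal (pow2_gt0 k)) G.

Definition invert_rows (k : nat) (s : 'cV[bool]_k) (G : 'M[bool]_(k, 2 ^ k)) :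
  'M[bool]_(k, 2 ^ k) :=
  \matrix_(i < k, j < 2 ^ k) (G i j (+) s i ord0).

(* The last column index has no successor, so it never contributes. *)
Definition transition_count (k : nat) (G : 'M[bool]_(k, 2 ^ k)) (i : 'I_k) : nat :=
  #|[set m : 'I_(2 ^ k) |
      [exists m' : 'I_(2 ^ k), (m' == m.+1 :> nat) && (G i m != G i m')]]|.

Definition transition_counts (k : nat) (G : 'M[bool]_(k, 2 ^ k)) : k.-tuple nat :=
  [tuple transition_count G i | i < k].

(* Each column is the sequence of its entries; the value at k = 0 is a dummy. *)
Fixpoint standard_gray_cols (k : nat) : seq (seq bool) :=
  match k with
  | 0 => [::]
  | 1 => [:: [:: false]; [:: true]]
  | k'.+1 => [seq rcons v false | v <- standard_gray_cols k'] ++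
             [seq rcons v true | v <- rev (standard_gray_cols k')]
  end.

Definition standard_gray (k : nat) : 'M[bool]_(k, 2 ^ k) :=
  \matrix_(i < k, j < 2 ^ k) nth false (nth [::] (standard_gray_cols k) j) i.

(* (2^(k-1), 2^(k-2), ..., 2, 1) *)
Definition standard_counts (k : nat) : k.-tuple nat :=
  [tuple 2 ^ (k.-1 - i) | i < k].

(* Main.v *)
Require Import Defs.
From mathcomp Require Import all_boot all_algebra zify.

Set Implicit Arguments.
Unset Strict Implicit.
Unset Printing Implicit Defensive.

(** A Gray code is determined by its first column and by the word of its
    2^k - 1 flipped rows, and a word comes from a Gray code iff none of its
    nonempty factors contains every letter an even number of times
    ([gray_code_path], [gray_codeP]); the transition counts are the numbers of
    occurrences of the letters ([transition_count_path]).

    Parity ([odd_card_gray_words]). Reversal is an involution on the Gray words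
    with given counts, so modulo 2 only palindromes u a u^R matter. In such a
    palindrome u avoids a: from u = p a q one would get the factor q a q^R a,
    in which every letter occurs evenly often. Hence u is a Gray word on the
    alphabet without a, and every such u gives back a Gray palindrome
    ([gray_word_pal]). The counts of the palindrome are 1 for a and twice those
    of u for the other letters, so that induction on the size of the alphabet
    leaves exactly the permutations of (1, 2, ..., 2^(k-1)).

    Uniqueness ([ruler_unique]). The standard code has the word
    r_(k+1) = r_k k r_k. By pigeonhole, a factor that only uses letters below t
    has length less than 2^t. Cutting a Gray word of length 2^k - 1 at its
    letters >= t, one sees that there are at least 2^(k-t) - 1 of these
    ([leq_size_count_big]). The counts 2^(k-1), ..., 2, 1 attain all these lower
    bounds. A word on k+1 letters attaining them contains the letter k once, so
    it is u k v with u and v Gray words on k letters; since the lower bounds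
    hold for u and v, both attain them, and u = v = r_k by induction. *)

(** * Words without balanced factors *)

Section Words.
Variable T : eqType.
Implicit Types (s u v w : seq T) (a b : T).

(** Every letter occurs an even number of times: flipping the coordinates listed
    by the word leads back to the starting vertex. *)
Definition balanced s := all (fun a => ~~ odd (count_mem a s)) s.

Lemma balancedP s : reflect (forall a, ~~ odd (count_mem a s)) (balanced s).
Proof.
apply: (iffP allP) => [H a|H a _]; last exact: H.
by have [/H//|/count_memPn->] := boolP (a \in s).
Qed.

Lemma perm_balanced u v : perm_eq u v -> balanced u -> balanced v.
Proof.
by move=> /permP uv /balancedP bu; apply/balancedP => a; rewrite -uv.
Qed.

(** The factor between the positions i and j is balanced iff the walk is at the
    same vertex at the times i and j. *)
Lemma balanced_take_drop w i j : i <= j ->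
  reflect (forall a, odd (count_mem a (take i w)) = odd (count_mem a (take j w)))
          (balanced (take (j - i) (drop i w))).
Proof.
move=> ij; have split_j : take j w = take i w ++ take (j - i) (drop i w).
  by rewrite -{1}(subnKC ij) takeD.
rewrite split_j; apply: (iffP (balancedP _)) => H a; move: (H a).
  by rewrite count_cat oddD => /negPf->; rewrite addbF.
by rewrite count_cat oddD; case: odd; case: odd.
Qed.

(** No nonempty factor is balanced: the walk that flips the coordinates listed
    by [w] never visits a vertex twice. The factors are written as
    [take j (drop i w)] to make the predicate boolean. *)
Definition self_avoiding w :=
  [forall i : 'I_(size w).+1, forall j : 'I_(size w).+1,
     balanced (take j (drop i w)) ==> nilp (take j (drop i w))].

Lemma self_avoidingP w :
  reflect (forall s, infix s w -> balanced s -> s = [::]) (self_avoiding w).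
Proof.
apply: (iffP idP) => [/forallP H s /infixP[p [q def_w]] bs|H].
  have lep : size p < (size w).+1 by rewrite def_w !size_cat; lia.
  have les : size s < (size w).+1 by rewrite def_w !size_cat; lia.
  have /forallP /(_ (Ordinal les)) /= := H (Ordinal lep).
  by rewrite def_w drop_size_cat // take_size_cat // bs => /nilP.
apply/forallP => i; apply/forallP => j; apply/implyP => b; apply/nilP.
by apply: H b; apply: infix_trans (infix_drop _ _); apply: infix_take.
Qed.

Lemma self_avoiding_infix u w :
  infix u w -> self_avoiding w -> self_avoiding u.
Proof.
move=> uw /self_avoidingP H; apply/self_avoidingP => s su.
exact/H/(infix_trans su).
Qed.

Lemma self_avoiding_rev w : self_avoiding w -> self_avoiding (rev w).
Proof.
move=> /self_avoidingP H; apply/self_avoidingP => s sw bs.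
apply: (can_inj revK); apply: H; first by rewrite -infix_rev revK.
by apply: perm_balanced bs; rewrite perm_sym perm_rev.
Qed.

Lemma self_avoiding_odd w i j : self_avoiding w -> i < j <= size w ->
  exists a, odd (count_mem a (take i w)) != odd (count_mem a (take j w)).
Proof.
move=> /self_avoidingP H /andP[ij jw].
have nb : ~~ balanced (take (j - i) (drop i w)).
  apply/negP => /H; rewrite (infix_trans (infix_take _ _) (infix_drop _ _)).
  by move=> /(_ isT) /(congr1 size); rewrite size_takel ?size_drop /=; lia.
move: nb => /allPn[a _]; rewrite negbK => oa; exists a.
rewrite -(subnKC (ltnW ij)) takeD count_cat oddD oa.
by case: odd.
Qed.

Lemma self_avoidingW w :
  (forall i j, i < j <= size w ->
    exists a, odd (count_mem a (take i w)) != odd (count_mem a (take j w))) ->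
  self_avoiding w.
Proof.
move=> H; apply/self_avoidingP => s /infixP[p [q def_w]] bs; apply/nilP.
rewrite /nilp; apply: contraT => nz.
have [|a] := H (size p) (size p + size s); first by rewrite def_w !size_cat; lia.
case/negP; apply/eqP; move: a; apply/balanced_take_drop; first lia.
by rewrite addKn def_w drop_size_cat // take_size_cat.
Qed.

Lemma balanced_double_pal v a : balanced (v ++ a :: rev v ++ [:: a]).
Proof.
apply/balancedP => b.
by rewrite !(count_cat, count_rev) /= !(count_cat, count_rev) /=; lia.
Qed.

(** The central fact on palindromes: the middle letter cannot occur in the first
    half, and this is the only new constraint. *)
Lemma self_avoiding_palE u a :
  self_avoiding (u ++ a :: rev u) = (a \notin u) && self_avoiding u.
Proof.
apply/idP/andP => [sa | [au sau]].
  split; last by apply: self_avoiding_infix sa; apply/infixP; exists [::], (a :: rev u).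
  (* With u = p a q, the palindrome contains the balanced factor q a q^R a. *)
  apply/negP => /splitPr au; case: au sa => p q /self_avoidingP.
  move=> /(_ (q ++ a :: rev q ++ [:: a])).
  rewrite balanced_double_pal.
  suff -> : infix (q ++ a :: rev q ++ [:: a]) ((p ++ a :: q) ++ a :: rev (p ++ a :: q)).
    by move=> /(_ isT isT); case: q.
  apply/infixP; exists (p ++ [:: a]), (rev p).
  by rewrite rev_cat rev_cons -cats1 -!catA /= -!catA.
apply: self_avoidingW => i j; rewrite size_cat /= size_rev => ij.
have take_big m : size u < m ->
    take m (u ++ a :: rev u) = u ++ a :: take (m - (size u).+1) (rev u).
  by move=> um; rewrite take_cat ltnNge (ltnW um) /= -(subnSK um).
have cu : count_mem a u = 0 by apply/count_memPn.
(* A factor lies in u, lies in rev u, or contains the only occurrence of a. *)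
have [ju|uj] := leqP j (size u).
  have [|b ob] := @self_avoiding_odd u i j sau; first lia.
  by exists b; rewrite !takel_cat //; lia.
have [iu|ui] := leqP i (size u).
  exists a; rewrite takel_cat // take_big // count_cat /= cu eqxx.
  have c0 s : a \notin s -> forall m, count_mem a (take m s) = 0.
    by move=> ns m; apply/count_memPn; apply: contra ns => /mem_take.
  by rewrite !c0 // mem_rev.
have [|b ob] := @self_avoiding_odd (rev u) (i - (size u).+1) (j - (size u).+1)
  (self_avoiding_rev sau); first by rewrite size_rev; lia.
exists b; rewrite !take_big // !count_cat /= !oddD.
by apply: contraNneq ob => /addbI/addbI->.
Qed.

End Words.

(** * Parity of the number of Gray words *)

Lemma odd_card_fixed (X : finType) (f : X -> X) (S : {set X}) :
  involutive f -> {in S, forall x, f x \in S} ->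
  odd #|S| = odd #|[set x in S | f x == x]|.
Proof.
move=> ff fS.
(* The moved points split into two sets exchanged by f, according to whether
   f increases or decreases the rank. *)
pose L := [set x in S | enum_rank x < enum_rank (f x)].
pose R := [set x in S | enum_rank (f x) < enum_rank x].
have eRL : R = f @: L.
  apply/setP => x; rewrite inE; apply/andP/imsetP.
    by move=> [xS lx]; exists (f x); rewrite // inE fS // ff.
  by move=> [y]; rewrite inE => /andP[yS ly] ->; rewrite fS // ff.
have eF : S :\: [set x in S | f x == x] = L :|: R.
  apply/setP => x; rewrite !inE; case: (x \in S); rewrite //= ?andbF // andbT.
  by rewrite -neq_ltn (inj_eq val_inj) (inj_eq enum_rank_inj) eq_sym.
have LR0 : #|L :&: R| = 0.
  apply/eqP; rewrite cards_eq0; apply/eqP/setP => x; rewrite !inE.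
  by apply/negP => /andP[/andP[_ a] /andP[_ b]]; move: (ltn_trans a b); rewrite ltnn.
have cRL : #|R| = #|L| by rewrite eRL card_imset //; exact: inv_inj.
have /setIidPr sF : [set x in S | f x == x] \subset S.
  by apply/subsetP => x; rewrite inE => /andP[].
by rewrite -(cardsID [set x in S | f x == x]) sF eF cardsU LR0 cRL; lia.
Qed.

Lemma palindromeP (T : Type) (m : nat) (w : seq T) :
  size w = m + m.+1 -> rev w = w ->
  exists a u, size u = m /\ w = u ++ a :: rev u.
Proof.
move=> sw rw; pose u := take m w.
have su : size u = m by rewrite size_takel // sw; lia.
case def_v: (drop m w) => [|a v].
  by move: (congr1 size def_v); rewrite size_drop sw /=; lia.
have def_w : w = u ++ a :: v by rewrite -def_v cat_take_drop.
have sv : size v = m.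
  by move: (congr1 size def_v); rewrite size_drop sw /=; lia.
exists a, u; split=> //; rewrite {1}def_w; congr (_ ++ _ :: _).
have : drop m.+1 (rev w) = rev u.
  by rewrite def_w rev_cat rev_cons cat_rcons -cat_rcons drop_size_cat //
     size_rcons size_rev sv.
by rewrite rw def_w -cat_rcons drop_size_cat // size_rcons su.
Qed.

Section Count.
Variable T : finType.
Implicit Types (A : {set T}) (c : T -> nat) (w : seq T).

(** A walk on the subsets of [A] that never revisits a vertex, with prescribed
    counts. Together with the length 2^#|A| - 1, required separately, this makes
    the walk Hamiltonian. Values of [c] outside [A] are irrelevant. *)
Definition gray_word A c w :=
  [&& all (mem A) w, self_avoiding w & [forall a in A, count_mem a w == c a]].

Lemma count_pal (u : seq T) a b :
  count_mem b (u ++ a :: rev u) = (count_mem b u).*2 + (a == b).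
Proof. by rewrite count_cat /= count_rev; lia. Qed.

Lemma gray_word_rev A c w : gray_word A c w -> gray_word A c (rev w).
Proof.
case/and3P => Aw sw /forall_inP cw; apply/and3P; split.
- by rewrite all_rev.
- exact: self_avoiding_rev.
by apply/forall_inP => a; rewrite count_rev; apply: cw.
Qed.

(** [a] is the possible middle letter of a palindrome with counts [c] on [A]. *)
Definition pivot A c a :=
  [&& a \in A, c a == 1 & [forall b in A :\ a, ~~ odd (c b)]].

Lemma gray_word_pal A c u a :
  gray_word A c (u ++ a :: rev u) =
  pivot A c a && gray_word (A :\ a) (fun b => (c b)./2) u.
Proof.
rewrite /gray_word /pivot self_avoiding_palE all_cat /= all_rev.
have [aA|_] := boolP (a \in A); rewrite /= ?andbF //.
apply/and3P/andP => [[/andP[uA _] /andP[au su] /forall_inP cu]|].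
  split.
    apply/andP; split; first by rewrite -(eqP (cu a aA)) count_pal (count_memPn au) eqxx.
    apply/forall_inP => b /setD1P[ba bA].
    by rewrite -(eqP (cu b bA)) count_pal [a == b]eq_sym (negPf ba) addn0 odd_double.
  apply/and3P; split=> //.
    apply/allP => b bu; rewrite !inE; apply/andP; split; last exact: (allP uA).
    by apply: contraNneq au => <-.
  apply/forall_inP => b /setD1P[ba bA].
  by rewrite -(eqP (cu b bA)) count_pal [a == b]eq_sym (negPf ba) addn0 doubleK.
move=> [/andP[/eqP ca /forall_inP co] /and3P[uA su /forall_inP cu]].
have au : a \notin u by apply/negP => /(allP uA); rewrite !inE eqxx.
have uA' : all (mem A) u by apply/allP => b /(allP uA) /setD1P[].
split; [by rewrite uA' | by rewrite au |].
apply/forall_inP => b bA; rewrite count_pal.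
have [<-|ab] := eqVneq a b; first by rewrite (count_memPn au) ca.
have bD : b \in A :\ a by rewrite !inE eq_sym ab.
by rewrite (eqP (cu b bD)) addn0 even_halfK // co.
Qed.

Lemma perm_enumD1 A a : a \in A -> perm_eq (enum A) (a :: enum (A :\ a)).
Proof.
move=> aA; apply: uniq_perm; rewrite ?enum_uniq //=.
  by rewrite enum_uniq mem_enum !inE eqxx.
move=> b; rewrite inE !mem_enum !inE.
by have [->|] := eqVneq.
Qed.

(** The sequence 1, 2, 4, ..., 2^(n-1). *)
Definition pow2s n := [seq 2 ^ i | i <- iota 0 n].

Lemma pow2sS n : pow2s n.+1 = 1 :: [seq i.*2 | i <- pow2s n].
Proof.
rewrite /pow2s /= (iotaDl 1 0) -!map_comp; congr (_ :: _).
by apply: eq_map => i /=; rewrite expnS mul2n.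
Qed.

(** The powers of two are 1 followed by even numbers, so the place of the 1 is a
    pivot. *)
Lemma perm_pow2s_pivot A c n :
  perm_eq [seq c a | a <- enum A] (pow2s n.+1) -> exists a, pivot A c a.
Proof.
rewrite pow2sS => pA.
have /mapP[a] : 1 \in [seq c a | a <- enum A] by rewrite (perm_mem pA) mem_head.
rewrite mem_enum => aA ca; exists a; rewrite /pivot aA -ca eqxx.
move: pA; rewrite (permPl (perm_map c (perm_enumD1 aA))) /=.
rewrite -ca perm_cons => pA; apply/forall_inP => b bA.
have : c b \in [seq c b | b <- enum (A :\ a)] by rewrite map_f ?mem_enum.
by rewrite (perm_mem pA) => /mapP[i _ ->]; rewrite odd_double.
Qed.

Lemma perm_pow2sS A c a n : pivot A c a ->
  perm_eq [seq c a | a <- enum A] (pow2s n.+1) =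
  perm_eq [seq (c b)./2 | b <- enum (A :\ a)] (pow2s n).
Proof.
case/and3P=> aA /eqP ca /forall_inP co.
rewrite pow2sS (permPl (perm_map c (perm_enumD1 aA))) /= ca perm_cons.
have -> : [seq c b | b <- enum (A :\ a)] =
          [seq i.*2 | i <- [seq (c b)./2 | b <- enum (A :\ a)]].
  rewrite -map_comp; apply/eq_in_map => b; rewrite mem_enum => bA /=.
  by rewrite even_halfK // co.
by apply/idP/idP => [/perm_map_inj|]; [apply; exact: double_inj|exact: perm_map].
Qed.

Lemma odd_card_gray_words A c (N : nat) : N.+1 = 2 ^ #|A| ->
  odd #|[set w : N.-tuple T | gray_word A c w]| =
  perm_eq [seq c a | a <- enum A] (pow2s #|A|).
Proof.
move: {2 3 4}#|A| (erefl #|A|) => n.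
elim: n => [|n IH] in A c N *.
  move=> /eqP; rewrite cards_eq0 => /eqP-> [->]; rewrite enum_set0 perm_refl.
  have -> : [set w : 0.-tuple T | gray_word set0 c w] = setT; last first.
    by rewrite cardsT card_tuple.
  apply/setP => w; rewrite !inE tuple0; apply/and3P; split=> //.
    by apply/self_avoidingP => s; rewrite infixs0 => /eqP.
  by apply/forall_inP => a; rewrite inE.
move=> cA defN; pose M := (2 ^ n).-1.
have defM : M.+1 = 2 ^ n by rewrite prednK // expn_gt0.
have NM : N = M + M.+1 by move: defN; rewrite expnS -defM; lia.
subst N.
rewrite (@odd_card_fixed _ (fun w : (M + M.+1).-tuple T => [tuple of rev w]));
  first 1 last.
- by move=> w; apply: val_inj; rewrite /= revK.
- by move=> w; rewrite !inE; apply: gray_word_rev.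
have palP (w : (M + M.+1).-tuple T) : gray_word A c w -> rev w = w ->
  exists a (u : M.-tuple T), [/\ pivot A c a,
    gray_word (A :\ a) (fun b => (c b)./2) u & w = u ++ a :: rev u :> seq T].
  move=> gw /(palindromeP (size_tuple w)) [a [u [/eqP su dw]]].
  exists a, (Tuple su); move: gw; rewrite dw gray_word_pal => /andP[? ?].
  by split.
have [/existsP[a pa]|/existsPn npa] := boolP [exists a, pivot A c a]; last first.
  rewrite [perm_eq _ _](_ : _ = false).
    rewrite (_ : [set w in _ | _] = set0) ?cards0 //; apply/setP => w; rewrite !inE.
    apply/negP => /andP[gw /eqP/(congr1 val) /= rw].
    by have [a [u [pa _ _]]] := palP w gw rw; case/negP: (npa a).
  by apply/negP => /perm_pow2s_pivot [a]; apply/negP.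
have aA : a \in A by case/and3P: pa.
have cD : #|A :\ a| = n by move: cA; rewrite (cardsD1 a) aA; lia.
rewrite (perm_pow2sS _ pa) -(IH _ _ M cD defM); congr odd.
pose f (u : M.-tuple T) : (M + M.+1).-tuple T := [tuple of u ++ a :: rev u].
have f_inj : injective f.
  move=> u v /(congr1 val) /= /eqP; rewrite eqseq_cat ?size_tuple // => /andP[/eqP uv _].
  exact: val_inj.
rewrite -(card_imset _ f_inj); apply: eq_card => w; rewrite inE; apply/andP/imsetP.
  rewrite inE => -[gw /eqP/(congr1 val) /= rw].
  have [b [u [pb gu dw]]] := palP w gw rw.
  (* The pivot is unique: it is the only letter of A with an odd count. *)
  suff ba : b = a by subst b; exists u; [rewrite inE|apply: val_inj].
  case/and3P: pa => _ /eqP ca _; case/and3P: pb => _ _ /forall_inP cb.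
  apply/eqP; apply: contraT => nba; move: (cb a).
  by rewrite !inE eq_sym nba aA ca => /(_ isT).
move=> [u]; rewrite inE => gu ->; rewrite inE gray_word_pal pa; split=> //.
by apply/eqP/val_inj; rewrite /= rev_cat rev_cons revK cat_rcons.
Qed.

End Count.

(** * Uniqueness of the word of the standard code *)

(** The word of the standard k-bit Gray code: the last letter k-1 occurs once, in
    the middle, between two copies of the word on the letters below it. *)
Fixpoint ruler k : seq nat :=
  if k is k'.+1 then ruler k' ++ k' :: ruler k' else [::].

Lemma size_ruler k : (size (ruler k)).+1 = 2 ^ k.
Proof. by elim: k => //= k; rewrite expnS size_cat /=; lia. Qed.

Lemma ruler_lt k : all (fun i => i < k) (ruler k).
Proof.
elim: k => //= k IH; rewrite all_cat /= ltnSn andbb.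
by apply: sub_all IH => i /ltnW.
Qed.

Lemma rev_ruler k : rev (ruler k) = ruler k.
Proof. by elim: k => //= k IH; rewrite rev_cat rev_cons IH cat_rcons. Qed.

Lemma count_ruler k i : i < k -> count_mem i (ruler k) = 2 ^ (k.-1 - i).
Proof.
elim: k => // k IH; rewrite ltnS leq_eqVlt /= count_cat /= => /predU1P[->|ik].
  have -> : count_mem k (ruler k) = 0.
    by apply/count_memPn/negP => /(allP (ruler_lt k)); rewrite ltnn.
  by rewrite eqxx subnn.
rewrite IH // gtn_eqF // add0n addnn -mul2n -expnS.
by congr (2 ^ _); lia.
Qed.

Lemma self_avoiding_ruler k : self_avoiding (ruler k).
Proof.
elim: k => [|k IH]; first by apply/self_avoidingP => s; rewrite infixs0 => /eqP.
rewrite /= -{2}(rev_ruler k) self_avoiding_palE IH andbT.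
by apply/negP => /(allP (ruler_lt k)); rewrite ltnn.
Qed.

(** Pigeonhole: the walk visits [(size w).+1] distinct vertices of the t-cube. *)
Lemma size_self_avoiding t (w : seq nat) :
  self_avoiding w -> all (fun i => i < t) w -> size w < 2 ^ t.
Proof.
move=> sw tw.
pose f (j : 'I_(size w).+1) := [set i : 'I_t | odd (count_mem (i : nat) (take j w))].
have f_lt (i j : 'I_(size w).+1) : i < j -> f i <> f j.
  move=> ij fij; have [|a] := self_avoiding_odd (i := i) (j := j) sw.
    by rewrite ij -ltnS /=.
  have [la|ta] := ltnP a t.
    by move/setP/(_ (Ordinal la)): fij; rewrite !inE /= => ->; rewrite eqxx.
  have aw : a \notin w by apply/negP => /(allP tw); rewrite ltnNge ta.
  by rewrite !(count_memPn (contra (@mem_take _ _ _ _) aw)).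
have f_inj : injective f.
  move=> i j fij; apply/val_inj => /=.
  by case: (ltngtP i j) => // [/f_lt|/f_lt]; rewrite fij.
have := leq_card f f_inj.
by rewrite card_ord -cardsT -powersetT card_powerset cardsT card_ord.
Qed.

(** The c letters >= t of [w] cut it into c + 1 factors of length less than 2^t. *)
Lemma leq_size_count_big t (w : seq nat) : self_avoiding w ->
  (size w).+1 <= 2 ^ t * (count (leq t) w).+1.
Proof.
have [n] := ubnP (size w); elim: n => // n IH in w *; rewrite ltnS => sn sw.
have [/hasP[a aw ta]|/hasPn nb] := boolP (has (leq t) w).
  pose u := take (find (leq t) w) w; pose v := drop (find (leq t) w).+1 w.
  have hb : has (leq t) w by apply/hasP; exists a.
  have fw : find (leq t) w < size w by rewrite -has_find.
  pose b := nth 0 w (find (leq t) w).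
  have dw : w = u ++ b :: v by rewrite /u /b /v -drop_nth // cat_take_drop.
  have tb : t <= b by exact: nth_find.
  have su : self_avoiding u by apply: self_avoiding_infix sw; exact: infix_take.
  have sv : self_avoiding v by apply: self_avoiding_infix sw; exact: infix_drop.
  have szw : size w = (size u + size v).+1 by rewrite dw size_cat /= addnS.
  have cw : count (leq t) w = (count (leq t) u + count (leq t) v).+1.
    by rewrite dw count_cat /= tb; lia.
  have := IH u _ su; have := IH v _ sv; rewrite cw szw; lia.
have -> : count (leq t) w = 0.
  by apply/eqP; rewrite -leqn0 leqNgt -has_count; apply/hasPn.
rewrite muln1; apply: size_self_avoiding => //.
by apply/allP => i /nb; rewrite ltnNge.
Qed.

(** The hypothesis says that the lower bounds of [leq_size_count_big] on the
    numbers of letters >= t are attained for all t. Unlike exact counts, these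
    upper bounds pass to the two halves of the word. *)
Lemma ruler_unique k (w : seq nat) :
    self_avoiding w -> all (fun i => i < k) w -> (size w).+1 = 2 ^ k ->
    (forall t, t <= k -> (count (leq t) w).+1 <= 2 ^ (k - t)) ->
  w = ruler k.
Proof.
elim: k w => [|k IH] w sw lw zw cw; first by case: w zw {sw lw cw}.
(* Without the letter k, the word would be shorter than 2^k. *)
have hb : has (leq k) w.
  apply: contraT => /hasPn nb; have := size_self_avoiding (t := k) sw.
  suff -> : all (fun i => i < k) w by move=> /(_ isT); rewrite expnS in zw; lia.
  by apply/allP => i /nb; rewrite ltnNge.
have hs : find (leq k) w < size w by rewrite -has_find.
have [u [v dw]] : exists u v, w = u ++ k :: v.
  exists (take (find (leq k) w) w), (drop (find (leq k) w).+1 w).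
  rewrite -[LHS](cat_take_drop (find (leq k) w)) (drop_nth 0) //.
  congr (_ ++ _ :: _); apply/eqP; rewrite eqn_leq (nth_find 0 hb) andbT.
  by have /allP := lw; apply; rewrite mem_nth.
have c_w t : t <= k -> (count (leq t) u).+1 + (count (leq t) v).+1 <= 2 * 2 ^ (k - t).
  move=> tk; have := cw t (leqW tk).
  by rewrite dw count_cat /= tk subSn // expnS; lia.
have [ck_u ck_v] : count (leq k) u = 0 /\ count (leq k) v = 0.
  by have := c_w k (leqnn k); rewrite subnn; lia.
have lt_k x : count (leq k) x = 0 -> all (fun i => i < k) x.
  move=> /eqP; rewrite -leqn0 leqNgt -has_count => /hasPn nb.
  by apply/allP => i /nb; rewrite ltnNge.
have su : self_avoiding u.
  by apply: self_avoiding_infix sw; apply/infixP; exists [::], (k :: v).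
have sv : self_avoiding v.
  by apply: self_avoiding_infix sw; apply/infixP; exists (rcons u k), [::];
     rewrite cats0 cat_rcons.
have zu := size_self_avoiding su (lt_k u ck_u).
have zv := size_self_avoiding sv (lt_k v ck_v).
have zuv : size w = (size u + size v).+1 by rewrite dw size_cat /= addnS.
rewrite expnS zuv in zw.
have zu1 : (size u).+1 = 2 ^ k by lia.
have zv1 : (size v).+1 = 2 ^ k by lia.
have lower t x : t <= k -> self_avoiding x -> (size x).+1 = 2 ^ k ->
    2 ^ (k - t) <= (count (leq t) x).+1.
  move=> tk sx zx; have := leq_size_count_big t sx.
  by rewrite zx -{1}(subnKC tk) expnD leq_pmul2l // expn_gt0.
have eu : u = ruler k.
  apply: (IH u su (lt_k u ck_u) zu1) => t tk.
  by have := c_w t tk; have := lower t v tk sv zv1; lia.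
have ev : v = ruler k.
  apply: (IH v sv (lt_k v ck_v) zv1) => t tk.
  by have := c_w t tk; have := lower t u tk su zu1; lia.
by rewrite dw {1}eu ev.
Qed.

Lemma ruler_unique_count k (w : seq nat) :
    self_avoiding w -> all (fun i => i < k) w -> (size w).+1 = 2 ^ k ->
    (forall i, i < k -> count_mem i w = 2 ^ (k.-1 - i)) ->
  w = ruler k.
Proof.
move=> sw lw zw cw; apply: ruler_unique => // t tk.
suff -> : (count (leq t) w).+1 = 2 ^ (k - t) by [].
(* Downward induction on t: 1 + (1 + 2 + ... + 2^(d-1)) = 2^d for d = k - t. *)
have [d ->] : exists d, t = k - d by exists (k - t); rewrite subKn.
elim: d {t tk} => [|d IH].
  rewrite subn0 subnn; congr _.+1; apply/eqP; rewrite -leqn0 leqNgt -has_count.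
  by apply/hasPn => i /(allP lw); rewrite ltnNge.
have [kd|dk] := leqP k d; first by rewrite (_ : k - d.+1 = k - d) //; lia.
set t := k - d.+1; have tS : k - d = t.+1 by rewrite /t; lia.
have -> : count (leq t) w = count_mem t w + count (leq t.+1) w.
  by elim: (w) => //= i x ->; lia.
rewrite -addnS -tS IH cw /t; last lia.
rewrite (_ : k.-1 - (k - d.+1) = d); last lia.
by rewrite (_ : k - (k - d) = d) 1?(_ : k - (k - d.+1) = d.+1) ?expnS; lia.
Qed.

(** * From words to Gray codes *)

(** The reversed second half of the standard code matches the second half of the
    ruler word because the ruler word is a palindrome. *)
Lemma standard_gray_colsE k :
  standard_gray_cols k.+1 =
  mkseq (fun j => mkseq (fun i => odd (count_mem i (take j (ruler k.+1)))) k.+1)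
        (2 ^ k.+1).
Proof.
elim: k => [//|k IH].
have zr := size_ruler k.+1.
set r := ruler k.+1 in IH zr *; set n := 2 ^ k.+1 in IH zr *.
have new_r : k.+1 \notin r by apply/negP => /(allP (ruler_lt _)); rewrite ltnn.
have c0 j : count_mem k.+1 (take j r) = 0.
  by apply/count_memPn; apply: contra new_r; exact: mem_take.
change (standard_gray_cols k.+2) with
  ([seq rcons v false | v <- standard_gray_cols k.+1] ++
   [seq rcons v true | v <- rev (standard_gray_cols k.+1)]).
have -> : ruler k.+2 = r ++ k.+1 :: r by [].
have zc : size (standard_gray_cols k.+1) = n by rewrite IH size_mkseq.
have n2 : 2 ^ k.+2 = n + n by rewrite expnS mul2n addnn.
apply: (@eq_from_nth _ [::]).
  by rewrite size_cat !size_map size_rev zc size_iota n2.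
move=> j; rewrite size_cat !size_map size_rev zc => lj.
rewrite nth_mkseq ?n2 // nth_cat size_map zc mkseqS.
have [jn|nj] := ltnP j n.
  rewrite (nth_map [::]) ?zc // takel_cat; last by rewrite -ltnS zr.
  by rewrite IH nth_mkseq // c0.
rewrite (nth_map [::]) ?size_rev ?zc; last lia.
rewrite nth_rev ?zc; last lia.
rewrite IH nth_mkseq; last lia.
have -> : take j (r ++ k.+1 :: r) = r ++ k.+1 :: take (j - n) r.
  rewrite take_cat ltnNge (_ : size r <= j) /=; last lia.
  by rewrite (_ : j - size r = (j - n).+1) //; lia.
congr rcons; last first.
  by rewrite count_cat /= eqxx c0 (count_memPn new_r).
apply/eq_in_map => i; rewrite mem_iota => /andP[_ ik].
rewrite count_cat /= (gtn_eqF ik) add0n.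
rewrite (_ : take (j - n) r = rev (drop (n - (j - n).+1) r)).
  by rewrite count_rev -{2}(cat_take_drop (n - (j - n).+1) r) count_cat !oddD addbK.
by rewrite -{1}[r]rev_ruler take_rev; congr (rev (drop _ r)); rewrite -zr subSS.
Qed.

Lemma standard_grayE k (i : 'I_k) (j : 'I_(2 ^ k)) :
  standard_gray k i j = odd (count_mem (i : nat) (take j (ruler k))).
Proof.
rewrite mxE; case: k i j => [[]//|k] i j.
by rewrite standard_gray_colsE nth_mkseq // nth_mkseq.
Qed.

Section Paths.
Variable k : nat.
Implicit Types (g : 'cV[bool]_k) (G : 'M[bool]_(k, 2 ^ k)) (w : seq 'I_k).

(** The matrix whose columns are the vertices visited from [g] by flipping the
    coordinates listed in [w]. *)
Definition path_mx g w : 'M[bool]_(k, 2 ^ k) :=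
  \matrix_(i < k, j < 2 ^ k) (g i ord0 (+) odd (count_mem i (take j w))).

Lemma first_col_path g w : first_col (path_mx g w) = g.
Proof. by apply/matrixP => i j; rewrite !mxE /= take0 /= addbF [j]ord1. Qed.

Lemma odd_count_takeS w m i (i0 : 'I_k) : m < size w ->
  odd (count_mem i (take m.+1 w)) =
  odd (count_mem i (take m w)) (+) (nth i0 w m == i).
Proof.
by move=> mw; rewrite (take_nth i0) // -cats1 count_cat oddD /= addn0 oddb.
Qed.

Lemma path_mx_inj g w1 w2 : size w1 = (2 ^ k).-1 -> size w2 = (2 ^ k).-1 ->
  path_mx g w1 = path_mx g w2 -> w1 = w2.
Proof.
move=> z1 z2 e12.
have count_eq m i : m < 2 ^ k ->
    odd (count_mem i (take m w1)) = odd (count_mem i (take m w2)).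
  by move=> mk; move/matrixP/(_ i (Ordinal mk)): e12; rewrite !mxE => /addbI.
have [/size0nil w0|] := posnP (size w1).
  by move: z1 z2; rewrite w0 => <- /size0nil ->.
case def_w: w1 => [//|i0 w'] _; rewrite -def_w in z1 count_eq *.
apply: (@eq_from_nth _ i0); first by rewrite z2.
move=> m mw; have mk : m.+1 < 2 ^ k by lia.
have := count_eq m.+1 (nth i0 w1 m) mk.
rewrite !(odd_count_takeS _ i0) ?z2 -?z1 // count_eq; last lia.
by move=> /addbI; rewrite eqxx => /esym/eqP.
Qed.

Lemma size_pow2 w : size w = (2 ^ k).-1 -> (size w).+1 = 2 ^ k.
Proof. by move=> ->; rewrite prednK // pow2_gt0. Qed.

Lemma gray_code_path g w : size w = (2 ^ k).-1 ->
  gray_code (path_mx g w) = self_avoiding w.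
Proof.
move=> /size_pow2 zw.
have col_eq (j j' : 'I_(2 ^ k)) : col j (path_mx g w) = col j' (path_mx g w) <->
    forall a, odd (count_mem a (take j w)) = odd (count_mem a (take j' w)).
  split=> [/matrixP e a|e]; first by have := e a ord0; rewrite !mxE => /addbI.
  by apply/matrixP => a b; rewrite !mxE e.
apply/andP/idP => [[/forallP col1 _]|sw].
  apply: self_avoidingW => i j /andP[ij jw].
  have jk : j < 2 ^ k by rewrite -zw.
  have ik : i < 2 ^ k by apply: ltn_trans jk.
  apply/existsP; apply: contraT => /existsPn e.
  have /cards1P[j0 e0] := col1 (col (Ordinal jk) (path_mx g w)).
  have : Ordinal ik \in [set j0].
    by rewrite -e0 inE; apply/eqP/col_eq => a; apply/eqP; have := e a; rewrite negbK.
  have : Ordinal jk \in [set j0] by rewrite -e0 inE.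
  rewrite !inE => /eqP<- /eqP/(congr1 val) /= eij.
  by move: ij; rewrite eij ltnn.
have col_inj : injective (fun j => col j (path_mx g w)).
  have lt_col (i j : 'I_(2 ^ k)) : i < j ->
      col i (path_mx g w) <> col j (path_mx g w).
    move=> ij /col_eq e; have [|a] := self_avoiding_odd (i := i) (j := j) sw.
      by rewrite ij -ltnS zw /=.
    by rewrite e eqxx.
  move=> i j eij; apply: val_inj => /=.
  by case: (ltngtP i j) => // /lt_col; rewrite eij.
split.
  have [f _ fK] : bijective (fun j => col j (path_mx g w)).
    by apply: inj_card_bij => //; rewrite card_mx card_bool card_ord muln1.
  apply/forallP => v; apply/cards1P; exists (f v).
  apply/setP => j; rewrite !inE; apply/eqP/eqP => [<-|->]; last exact: fK.
  by apply: col_inj; rewrite fK.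
apply/forallP => m; apply/forallP => m'; apply/implyP => /eqP mm'.
have mw : m < size w by rewrite -ltnS zw -mm' ltn_ord.
have i0 : 'I_k by case: (w) mw => // i.
apply/cards1P; exists (nth i0 w m); apply/setP => i; rewrite !inE !mxE mm'.
rewrite (odd_count_takeS _ i0) // (inj_eq (@addbI _)) [i == _]eq_sym.
by case: odd; case: (_ == i).
Qed.

Lemma transition_count_path g w i : size w = (2 ^ k).-1 ->
  transition_count (path_mx g w) i = count_mem i w.
Proof.
move=> /size_pow2 zw.
pose F m := (m < size w) && (nth i w m == i).
have -> : transition_count (path_mx g w) i = #|[set m : 'I_(2 ^ k) | F m]|.
  apply: eq_card => m; rewrite !inE /F; apply/existsP/andP.
    move=> [m' /andP[/eqP mm' ]]; rewrite !mxE mm'.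
    have mw : m < size w by rewrite -ltnS zw -mm' ltn_ord.
    by rewrite (odd_count_takeS _ i) //; case: (_ == i); rewrite // addbF eqxx.
  move=> [mw nw]; have mk : m.+1 < 2 ^ k by move: mw; rewrite -ltnS zw.
  exists (Ordinal mk); rewrite !mxE /= eqxx (odd_count_takeS _ i) // nw.
  by case: (g _ _); case: odd.
rewrite -sum1dep_card big_mkcond /=.
rewrite -(big_mkord xpredT (fun m => if F m then 1 else 0)) -zw.
(* The last column has no successor and contributes nothing. *)
rewrite big_nat_recr //= {2}/F ltnn /= addn0 -big_mkcond -sum1_count.
rewrite (big_nth i) [RHS]big_mkcond.
rewrite big_mkcond; apply: eq_big_nat => m /andP[_ mw].
by rewrite /F mw.
Qed.

Lemma gray_codeP G : gray_code G ->
  exists w, size w = (2 ^ k).-1 /\ G = path_mx (first_col G) w.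
Proof.
case/andP=> _ /forallP flip.
have step (m : 'I_(2 ^ k).-1) : exists i, forall m1 m2 : 'I_(2 ^ k),
    m1 = m :> nat -> m2 = m.+1 :> nat -> forall a, G a m2 = G a m1 (+) (i == a).
  have mk : m.+1 < 2 ^ k by have := ltn_ord m; lia.
  have /forallP/(_ (Ordinal mk))/implyP := flip (Ordinal (ltnW mk)).
  case/(_ (eqxx _))/cards1P => i fi; exists i => m1 m2 e1 e2 a.
  have -> : m1 = Ordinal (ltnW mk) by apply: val_inj.
  have -> : m2 = Ordinal mk by apply: val_inj.
  move/setP/(_ a): fi; rewrite !inE [a == i]eq_sym => <-.
  by case: (G a _); case: (G a _).
have [f fP] := fin_all_exists step.
pose w := [seq f m | m <- enum 'I_(2 ^ k).-1].
have zw : size w = (2 ^ k).-1 by rewrite size_map size_enum_ord.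
exists w; split=> //; apply/matrixP => i [j jk]; rewrite !mxE.
elim: j jk => [|j IH] jk; first by rewrite take0 addbF; congr (G i _); apply: val_inj.
have jw : j < (2 ^ k).-1 by lia.
rewrite (fP (Ordinal jw) (Ordinal (ltnW jk))) // IH /=.
rewrite (odd_count_takeS _ i) ?zw // addbA; congr (_ (+) (_ == _)).
rewrite (nth_map (Ordinal jw)) ?size_enum_ord //; congr (f _).
by apply: val_inj; rewrite /= nth_enum_ord.
Qed.

End Paths.

Lemma word_ord k (w : seq nat) : all (fun i => i < k) w ->
  exists u : seq 'I_k, map val u = w.
Proof.
elim: w => [|i w IH] /=; first by exists [::].
by case/andP=> ik /IH[u <-]; exists (Ordinal ik :: u).
Qed.

Lemma count_val k (u : seq 'I_k) (i : 'I_k) :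
  count_mem (i : nat) (map val u) = count_mem i u.
Proof. by rewrite count_map; apply: eq_count => j /=. Qed.

Lemma self_avoiding_map (S T : eqType) (f : S -> T) (u : seq S) : injective f ->
  self_avoiding (map f u) = self_avoiding u.
Proof.
move=> f_inj.
have bal s : balanced (map f s) = balanced s.
  rewrite /balanced all_map; apply: eq_all => a /=; rewrite count_map.
  by congr (~~ odd _); apply: eq_count => b /=; rewrite (inj_eq f_inj).
apply/self_avoidingP/self_avoidingP => H s /infixP[p [q e]] bs.
  have : map f s = [::].
    apply: H; rewrite ?bal //; apply/infixP; exists (map f p), (map f q).
    by rewrite e !map_cat.
  by move=> /(congr1 size); rewrite size_map => /size0nil.
have ds : s = map f (take (size s) (drop (size p) u)).
  by rewrite map_take map_drop e drop_size_cat // take_size_cat.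
rewrite ds (H (take (size s) (drop (size p) u))) -?bal -?ds //.
exact: infix_trans (infix_take _ _) (infix_drop _ _).
Qed.

Lemma standard_countsE k :
  standard_counts k = [seq 2 ^ (k.-1 - i) | i <- iota 0 k] :> seq nat.
Proof. by rewrite /= -val_enum_ord -map_comp. Qed.

Lemma perm_standard_counts k : perm_eq (standard_counts k) (pow2s k).
Proof.
rewrite standard_countsE -(perm_rev (map _ _)) -map_rev /pow2s.
suff -> : [seq 2 ^ (k.-1 - i) | i <- rev (iota 0 k)] = pow2s k by [].
apply: (@eq_from_nth _ 0); rewrite !size_map ?size_rev // => i; rewrite size_iota => ik.
rewrite !(nth_map 0) ?size_rev ?size_iota // nth_rev size_iota // !nth_iota //; last lia.
by congr (2 ^ _); lia.
Qed.

Theorem theorem1p1 (k : nat) (hk : 1 <= k) :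
  [/\ gray_code (standard_gray k) /\
        transition_counts (standard_gray k) = standard_counts k,
      (forall G : 'M[bool]_(k, 2 ^ k),
         gray_code G -> transition_counts G = standard_counts k ->
         exists s : 'cV[bool]_k, G = invert_rows s (standard_gray k)),
      (forall g : 'cV[bool]_k,
         exists! G : 'M[bool]_(k, 2 ^ k),
           [/\ gray_code G, first_col G = g
             & transition_counts G = standard_counts k])
    & (forall (c : k.-tuple nat) (g : 'cV[bool]_k),
         odd #|[set G : 'M[bool]_(k, 2 ^ k) |
                 [&& gray_code G, first_col G == g & transition_counts G == c]]|
         <-> perm_eq c (standard_counts k))].
Proof.
have [r def_r] := word_ord (ruler_lt k).
have zr : size r = (2 ^ k).-1 by rewrite -size_ruler -def_r size_map.
have sr : self_avoiding r.
  by rewrite -(self_avoiding_map _ val_inj) def_r self_avoiding_ruler.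
have countsP g w (c : k.-tuple nat) : size w = (2 ^ k).-1 ->
    transition_counts (path_mx g w) = c <-> forall i, count_mem i w = tnth c i.
  move=> zw; split=> [<- i|cw]; first by rewrite tnth_mktuple transition_count_path.
  by apply: eq_from_tnth => i; rewrite tnth_mktuple transition_count_path.
have gray_r g : gray_code (path_mx g r) by rewrite gray_code_path.
have counts_r g : transition_counts (path_mx g r) = standard_counts k.
  by apply/countsP => // i; rewrite tnth_mktuple -count_val def_r count_ruler.
have std_r s : invert_rows s (standard_gray k) = path_mx s r.
  apply/matrixP => i j; rewrite mxE standard_grayE !mxE addbC -def_r.
  by rewrite -map_take count_val.
have std0 : standard_gray k = path_mx 0%R r.
  rewrite -std_r; apply/matrixP => i j; rewrite [RHS]mxE.
  by rewrite [X in _ (+) X](_ : _ = false) ?addbF // mxE.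
have uniq_r G : gray_code G -> transition_counts G = standard_counts k ->
    G = path_mx (first_col G) r.
  move=> gG; have [w [zw dG]] := gray_codeP gG.
  rewrite {1}dG => /(countsP _ _ _ zw) cw; rewrite {1}dG; congr path_mx.
  apply: (inj_map val_inj); rewrite def_r; apply: ruler_unique_count.
  - rewrite self_avoiding_map; last exact: val_inj.
    by rewrite -(gray_code_path (first_col G) zw) -dG.
  - by rewrite all_map; apply/allP => i _ /=.
  - by rewrite size_map size_pow2.
  by move=> i ik; rewrite (count_val w (Ordinal ik)) cw tnth_mktuple.
split.
- by rewrite std0.
- by move=> G gG cG; exists (first_col G); rewrite std_r; exact: uniq_r.
- move=> g; exists (path_mx g r); split; first by rewrite first_col_path.
  by move=> G [gG <- cG]; rewrite -uniq_r.
move=> c g; pose N := (2 ^ k).-1.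
have gw_inj : injective (fun w : N.-tuple 'I_k => path_mx g w).
  by move=> w1 w2 /path_mx_inj e; apply: val_inj; apply: e; rewrite size_tuple.
pose W := [set w : N.-tuple 'I_k | gray_word setT (tnth c) w].
have -> : [set G : 'M[bool]_(k, 2 ^ k) |
    [&& gray_code G, first_col G == g & transition_counts G == c]] =
    [set path_mx g w | w : N.-tuple 'I_k in W].
  apply/setP => G; rewrite inE; apply/and3P/imsetP.
    move=> [gG /eqP fG /eqP cG]; have [w [/eqP zw dG]] := gray_codeP gG.
    rewrite fG in dG; exists (Tuple zw) => //; rewrite inE; apply/and3P; split.
    + by apply/allP => i _; rewrite /= inE.
    + by rewrite -(gray_code_path g (eqP zw)) -dG.
    have /(countsP g _ _ (eqP zw)) cw : transition_counts (path_mx g w) = c.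
      by rewrite -dG.
    by apply/forall_inP => i _; apply/eqP/cw.
  move=> [w]; rewrite inE => /and3P[_ sw /forall_inP cw] ->.
  rewrite gray_code_path ?size_tuple // first_col_path sw eqxx; split=> //.
  by apply/eqP/countsP => [|i]; [rewrite size_tuple|apply/eqP/cw; rewrite inE].
rewrite card_imset // (odd_card_gray_words (A := setT)); last first.
  by rewrite cardsT card_ord prednK // pow2_gt0.
rewrite (permPr (perm_standard_counts k)) cardsT card_ord.
suff -> : [seq tnth c a | a <- enum [set: 'I_k]] = c by [].
by rewrite enum_setT -enumT map_tnth_enum.
Qed.
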